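(* For every integer $n\ge 1$, $\tilde d_n(x)$ is a polynomial in $x$ and $q$ with nonnegative integer coefficients. Hence, for all integers $n\ge 0$ and $0\le j\le n$, the polynomial $c(n,j)$ in $q$ has nonnegative coefficients (Andrews' conjecture).
   Context: Let $x,q$ be commuting indeterminates. A Schur partition is a partition into positive integer parts such that any two parts differ by at least $3$ and no two consecutive multiples of $3$ (i.e. $3k$ and $3k+3$) both occur as parts; the empty partition is included. For $N\ge 1$ let $D_N(m,n)$ be the number of Schur partitions $\pi$ of $n$ with all parts $\le N$ such that (number of parts of $\pi$) + (number of even parts of $\pi$) $=m$. The Alladi-Schur polynomials are $d_N(x)=\sum_{m,n\ge 0}D_N(m,n)x^mq^n$ for $N\ge 1$, with the convention $d_{-1}(x)=d_0(x)=1$. For $n\ge 0$ let $p_n(x)=\prod_{i=1}^n(1+xq^{2i-1}+x^2q^{4i-2})$ (so $p_0(x)=1$). Let $\chi_o(n)=1$ if $n$ is odd and $0$ if $n$ is even. For $n\ge -1$ define $$\tilde d_n(x)=\frac{d_n(x)}{p_{e(n)}(x)},\qquad e(n)=\left\lceil\frac{n+3\chi_o(n)}{6}\right\rceil-\chi_o(n).$$ This quotient makes sense as a formal power series in $x$ over $\mathbb{Z}[q]$, since $p_{e(n)}(0)=1$; a theorem of Andrews states that $p_{e(n)}(x)$ divides $d_n(x)$. The $c(n,i)\in\mathbb{Z}[q]$ are defined for $n\ge 0$ by $\frac{d_{6n-1}(x)}{p_n(x)}=\sum_{i=0}^n c(n,i)x^i$ (by a theorem of Andrews the left-hand side is a polynomial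 in $x$ of degree at most $n$). *)

(* Defs.v *)
From HB Require Import structures.
From mathcomp Require Import all_boot all_order all_algebra.

Set Implicit Arguments.
Unset Strict Implicit.
Unset Printing Implicit Defensive.

Import Order.TTheory GRing.Theory Num.Theory.

Local Open Scope ring_scope.

(* A partition is the weakly decreasing sequence of its (positive) parts. *)
Definition is_partition (s : seq nat) : bool :=
  sorted geq s && all (fun a => 0 < a)%N s.

Definition is_schur (s : seq nat) : bool :=
  [&& is_partition s,
      pairwise (fun a b => b + 3 <= a)%N s &
      all (fun a => (3 %| a)%N ==> ((a + 3)%N \notin s)) s].

Definition schur_weight (s : seq nat) : nat :=
  (size s + count (fun a => ~~ odd a) s)%N.

(* A partition of n has at most n parts, so the partitions of n into parts at
   most N all lie in the finite type of sequences over {0, ..., N} of length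
   at most n. *)
Definition schur_count (N m n : nat) : nat :=
  #|[set s : {bseq n of 'I_N.+1} |
      let t := [seq val a | a <- s] in
      [&& is_schur t, sumn t == n & schur_weight t == m]]|.

(* Polynomials in x and q are elements of Z[q][x]: the outer variable is x and
   the inner one is q. *)
Notation Zqx := {poly {poly int}}.

(* The truncation of the generating function is harmless, the counts vanish
   beyond the bounds: see coef_schur_poly. *)
Definition schur_poly (N : nat) : Zqx :=
  \poly_(m < (2 * N).+1) \poly_(n < (N * N).+1) (schur_count N m n)%:Z.

(* d_N(x), with d_{-1} = d_0 = 1; only indices N >= -1 are meaningful. *)
Definition alladi_schur (N : int) : Zqx :=
  if N <= 0 then 1 else schur_poly `|N|%N.

Definition p_poly (n : nat) : Zqx :=
  \prod_(1 <= i < n.+1)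
    (1 + ('X^(2 * i - 1) : {poly int}) *: 'X
       + ('X^(4 * i - 2) : {poly int}) *: 'X^2).

(* Formal power series in x over a commutative ring are coefficient sequences.
   [psdiv f h] is the quotient f / h in R[[x]] of polynomials with h(0) = 1,
   expanded as \sum_k f (1 - h)^k; the terms k > i do not contribute to the
   coefficient of x^i. See psdivP and psdiv_unique. *)
Definition psdiv (R : comNzRingType) (f h : {poly R}) : nat -> R :=
  fun i => (\sum_(k < i.+1) f * (1 - h) ^+ k)`_i.

Definition chi_odd (n : int) : int := (odd `|n|%N)%:Z.

Definition e_index (n : int) : int :=
  Num.ceil ((n + 3 * chi_odd n)%:~R / 6 : rat) - chi_odd n.

(* e_index n >= 0 whenever n >= -1, so the absolute value is a mere cast to nat: see
   e_index_ge0. *)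
Definition dtilde (n : int) : nat -> {poly int} :=
  psdiv (alladi_schur n) (p_poly `|e_index n|%N).

(* c(n, i) is the coefficient of x^i in d_{6n-1}(x) / p_n(x): see c_coefP. *)
Definition c_coef (n i : nat) : {poly int} :=
  psdiv (alladi_schur (6 * n%:Z - 1)) (p_poly n) i.

Definition nonneg_coefs (f : {poly int}) : Prop := forall k, 0 <= f`_k.

(* A series in x over Z[q] that is a polynomial in x and q with nonnegative
   integer coefficients. *)
Definition is_nonneg_poly (s : nat -> {poly int}) : Prop :=
  exists P : Zqx, (forall i, s i = P`_i) /\ (forall i, nonneg_coefs P`_i).

Lemma schur_count_bound N m n :
  schur_count N m n != 0%N -> (m <= 2 * N)%N && (n <= N * N)%N.
Proof.
rewrite cards_eq0 => /set0Pn[s]; rewrite inE /=.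
set t := [seq _ | a <- s] => /and3P[/and3P[/andP[_ pos] pw _] /eqP <- /eqP <-].
have tN a : a \in t -> (a <= N)%N.
  by case/mapP=> b _ ->; rewrite -ltnS; exact: ltn_ord.
have sz : (size t <= N)%N.
  have ut : uniq t.
    rewrite uniq_pairwise; apply: sub_pairwise pw => a b /= ab.
    by apply: contraTneq ab => ->; rewrite -{2}[b]addn0 leq_add2l.
  rewrite -[N in leqRHS](size_iota 1); apply: uniq_leq_size => // a ta.
  by rewrite mem_iota add1n ltnS tN // andbT (allP pos).
apply/andP; split.
  by rewrite /schur_weight mul2n -addnn leq_add // (leq_trans (count_size _ _)).
apply: (@leq_trans (size t * N)); last by rewrite leq_mul2r sz orbT.
elim: (t) tN => //= a r IH rN; rewrite mulSn leq_add ?rN ?mem_head // IH // => b br.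
by rewrite rN // inE br orbT.
Qed.

Lemma coef_schur_poly N m n :
  (schur_poly N)`_m`_n = (schur_count N m n)%:Z.
Proof.
have := @schur_count_bound N m n.
rewrite coef_poly ltnS; case: leqP => lm; rewrite ?coef_poly ?ltnS ?coef0.
  case: leqP => // ln; case: eqP => [->|_] // /(_ isT); by rewrite andbF.
by case: eqP => [->|_] // /(_ isT).
Qed.

Lemma psdivP (R : comNzRingType) (f h : {poly R}) :
  h`_0 = 1 -> forall i, \sum_(j < i.+1) psdiv f h j * h`_(i - j) = f`_i.
Proof.
move=> h0 i.
have [g gE] : exists g, 1 - h = g * 'X.
  exists (\poly_(k < size (1 - h)) (1 - h)`_k.+1).
  apply/polyP => k; rewrite coefMX; case: k => [|k].
    by rewrite coefB coef1 h0 subrr.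
  rewrite coef_poly /=; case: ltnP => // sk.
  by rewrite nth_default // (leq_trans sk).
have small k j : (j < k)%N -> (f * (1 - h) ^+ k)`_j = 0.
  by move=> jk; rewrite gE exprMn mulrA coefMXn jk.
pose S := \sum_(k < i.+1) f * (1 - h) ^+ k.
have SE j : (j <= i)%N -> psdiv f h j = S`_j.
  move=> ji; rewrite /psdiv /S !coef_sum.
  rewrite (big_ord_widen i.+1 (fun k => (f * (1 - h) ^+ k)`_j)) ?ltnS //.
  rewrite big_mkcond; apply: eq_bigr => k _ /=.
  by case: ltnP => // jk; rewrite small.
have -> : \sum_(j < i.+1) psdiv f h j * h`_(i - j) = (S * h)`_i.
  rewrite coefM; apply: eq_bigr => j _; by rewrite SE // -ltnS.
have -> : S * h = f - f * (1 - h) ^+ i.+1.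
  have := subrX1 (1 - h) i.+1; rewrite addrAC subrr add0r => geom.
  rewrite /S -mulr_sumr -mulrA [_ * h]mulrC -[h * _]opprK -mulNr -geom.
  by rewrite opprB mulrBr mulr1.
by rewrite coefB small // subr0.
Qed.

Lemma psdiv_unique (R : comNzRingType) (f h : {poly R}) (s : nat -> R) :
  h`_0 = 1 -> (forall i, \sum_(j < i.+1) s j * h`_(i - j) = f`_i) ->
  s =1 psdiv f h.
Proof.
move=> h0 sE i; elim/ltn_ind: i => i IH.
have := sE i; rewrite -(psdivP f h0) !big_ord_recr /= subnn h0 !mulr1.
rewrite (eq_bigr (fun j : 'I_i => psdiv f h j * h`_(i - j))).
  exact: addrI.
by move=> j _; rewrite IH.
Qed.

Lemma p_poly0 n : (p_poly n)`_0 = 1.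
Proof.
rewrite -horner_coef0 /p_poly horner_prod big1 // => i _.
by rewrite !(hornerD, hornerZ, hornerXn, hornerX, hornerC) expr0n !mulr0 !addr0.
Qed.

Lemma e_index_ge0 (n : int) : -1 <= n -> 0 <= e_index n.
Proof.
move=> n1; rewrite /e_index /chi_odd subr_ge0; case: odd => /=.
  by rewrite -gtz0_ge1 ceil_gt0 divr_gt0 // ltr0z -ltrBlDr
     (lt_le_trans _ n1).
rewrite mulr0 addr0 ceil_ge0 ltr_pdivlMr // mulN1r.
by apply: (@lt_le_trans _ _ (-1)%:~R); rewrite // ler_int.
Qed.

Lemma c_coefP n (C : nat -> {poly int}) :
  alladi_schur (6 * n%:Z - 1) = (\poly_(i < n.+1) C i) * p_poly n ->
  forall i, (i <= n)%N -> c_coef n i = C i.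
Proof.
move=> dE i lin; rewrite /c_coef -(@psdiv_unique _ _ _ (fun j => (\poly_(i < n.+1) C i)`_j)).
- by rewrite coef_poly ltnS lin.
- exact: p_poly0.
- by move=> k; rewrite dE coefM.
Qed.

(* Main.v *)
Require Import Defs.
From mathcomp Require Import all_boot all_order all_algebra.
From mathcomp Require Import zify ring.

(** Conditioning on the largest part gives d_N = d_(N-1) + w(N) d_g, where
    w(N) is x q^N or x^2 q^N according to the parity of N and g is the largest
    value that the next part may take: N - 3, or N - 4 if 3 divides N
    ([schur_poly_rec]).  Write A, C, E, G for d_(6k-1), d_(6k+1), d_(6k+2),
    d_(6k+4), and put S f(x) = f(x q^2).  The recurrence makes (E, G) a linear
    image L_k (A, C), and the next pair (A, C) a linear image R_k (E, G), with
    2 x 2 matrices over Z[x, q].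

    The heart of the proof is that E = F S A and G = F S C with
    F = 1 + x q + x^2 q^2 ([functional_equations]).  This follows by induction
    on k from the matrix identity S(R_k) S(L_k) = L_(k+1) R_k: applying S to
    the passage from one block of six indices to the next amounts to starting
    half a block later.

    Since p_(k+1) = F S p_k as well, the functional equations yield
    E / p_(k+1) = S (A / p_k) and G / p_(k+1) = S (C / p_k).  These are the two
    quotients of a block in which the recurrence alone would require a
    division by 1 + x q^(2k+1) + x^2 q^(4k+2); the other four are combinations
    of quotients already treated, with nonnegative coefficients, and S
    preserves nonnegativity.  So all quotients of a block are nonnegative as soon as
    A / p_k and C / p_k are, and the next A and C belong to the same block
    ([schur_poly_nonneg_block]). *)

Set Implicit Arguments.
Unset Strict Implicit.
Unset Printing Implicit Defensive.

Import Order.TTheory GRing.Theory Num.Theory.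

Local Open Scope ring_scope.

(** * Enumerating Schur partitions by their largest part *)

(** The ambient list in which the Schur partitions are selected is structurally
    recursive in the largest part, unlike the Schur partitions themselves, whose
    recursion goes back three or four steps. *)
Fixpoint strict_partitions (N : nat) : seq (seq nat) :=
  if N is M.+1 then
    strict_partitions M ++ [seq M.+1 :: s | s <- strict_partitions M]
  else [:: [::]].

Lemma mem_strict_partitions N s :
  (s \in strict_partitions N) =
  sorted gtn s && all (fun a => 0 < a <= N)%N s.
Proof.
have path_le a t : path gtn a t -> all (fun b => b < a)%N t.
  by move=> h; apply: (order_path_min _ h) => x y z; rewrite /=; lia.
elim: N s => [|N IH] s; first by case: s => [|[|a] s] //=; rewrite andbF.
rewrite mem_cat IH; apply/orP/andP => [[/andP[ss sN]|/mapP[t]]|[ss sN]].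
- by split=> //; apply: sub_all sN => a; lia.
- rewrite IH => /andP[st tN] ->; split=> /=.
    by case: t st tN => //= b t -> /andP[bN _]; rewrite andbT; lia.
  by apply/andP; split; [lia|apply: sub_all tN => a; lia].
case: s ss sN => [|a s] /=; first by left.
move=> pas /andP[aN sN]; have [aE|aE] := eqVneq a N.+1.
  right; apply/mapP; exists s; last by rewrite aE.
  rewrite IH (path_sorted pas) /=; apply/allP => b bs.
  by move/(_ _ _ pas)/allP/(_ _ bs): path_le; move/allP/(_ _ bs): sN; lia.
left; rewrite pas /=; apply/andP; split; first lia.
apply/allP => b bs.
by move/(_ _ _ pas)/allP/(_ _ bs): path_le; move/allP/(_ _ bs): sN; lia.
Qed.

Lemma strict_partitions_uniq N : uniq (strict_partitions N).
Proof.
elim: N => //= N IH; rewrite cat_uniq IH map_inj_uniq ?IH ?andbT; last by move=> s t [].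
apply/hasPn => _ /mapP[t _ ->]; rewrite mem_strict_partitions /= ltnn.
by rewrite andbF.
Qed.

Lemma filter_strict_partitions g N : (g <= N)%N ->
  [seq s <- strict_partitions N | all (fun b => b <= g)%N s] =
  strict_partitions g.
Proof.
elim: N => [|N IH]; first by rewrite leqn0 => /eqP->.
rewrite leq_eqVlt => /orP[/eqP gN|gN].
  rewrite gN; apply/all_filterP/allP => s.
  rewrite mem_strict_partitions => /andP[_]; apply: sub_all => a; lia.
rewrite /= filter_cat IH // filter_map.
by rewrite (eq_filter (a2 := pred0)) ?filter_pred0 ?cats0 // => s /=; lia.
Qed.

Definition schur_partitions N := [seq s <- strict_partitions N | is_schur s].

Lemma schur_strict s : is_schur s -> sorted gtn s && all (fun a => 0 < a)%N s.
Proof.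
case/and3P=> /andP[_ ->] h _; rewrite andbT.
apply: (@sub_sorted _ (fun a b => b + 3 <= a)%N) => [a b|]; first by move=> /=; lia.
by rewrite -sorted_pairwise in h => // a b c /=; lia.
Qed.

Lemma mem_schur_partitions N s :
  (s \in schur_partitions N) = is_schur s && all (fun a => a <= N)%N s.
Proof.
rewrite mem_filter mem_strict_partitions; case: (boolP (is_schur s)) => //=.
move=> /schur_strict/andP[-> s0] /=.
by apply: eq_in_all => a /(allP s0) ->.
Qed.

(** Truncated subtraction turns the bound into 0 for a <= 3, where no further
    part fits; the convention d_(-1) = d_0 = 1 is absorbed in this way. *)
Definition next_part_bound (a : nat) : nat := (a - 3 - (3 %| a))%N.

(** The condition on consecutive multiples of 3 only matters between adjacent
    parts: a part a divisible by 3 excludes a - 3, which is itself a multiple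
    of 3 and the only value at distance exactly 3. *)
Lemma is_schur_cons a s : (0 < a)%N ->
  is_schur (a :: s) = is_schur s && all (fun b => b <= next_part_bound a)%N s.
Proof.
move=> a0; apply/idP/andP.
  case/and3P=> /andP[/= /path_sorted ss /andP[_ s0]] /= /andP[ha pw].
  case/andP=> _ h3; split.
    apply/and3P; split=> //; first by rewrite /is_partition ss s0.
    by apply: sub_all h3 => b; rewrite inE negb_or; case: (3 %| b)%N => //= /andP[].
  apply/allP => b bs; move: (allP ha _ bs) (allP s0 _ bs) (allP h3 _ bs).
  rewrite inE negb_or /next_part_bound => hb hb0.
  case: (boolP (3 %| b)%N) => h3b /=; last by lia.
  by case/andP=> + _; lia.
case=> /and3P[/andP[ss s0] pw h3] /allP hs.
have small b : b \in s -> (b + 3 <= a)%N.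
  by move=> bs; move: (hs _ bs) (allP s0 _ bs); rewrite /next_part_bound; lia.
apply/and3P; split.
- rewrite /is_partition /= a0 s0 path_min_sorted ?ss //.
  by apply/allP => b /small /=; lia.
- by rewrite /= pw andbT; apply/allP.
apply/allP => b; rewrite inE => /orP[/eqP->|bs].
  apply/implyP => _; rewrite inE negb_or; apply/andP; split; first lia.
  by apply/negP => /small; lia.
move: (allP h3 _ bs) (hs _ bs) (allP s0 _ bs).
rewrite inE negb_or /next_part_bound; case: (boolP (3 %| b)%N) => //= h3b ->.
by rewrite andbT => ? ?; apply/eqP => abE; move: h3b; rewrite -(dvdn_addl b (dvdnn 3)); lia.
Qed.

Lemma schur_partitionsS N :
  schur_partitions N.+1 =
  schur_partitions N ++
  [seq N.+1 :: s | s <- schur_partitions (next_part_bound N.+1)].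
Proof.
have gN : (next_part_bound N.+1 <= N)%N by rewrite /next_part_bound; lia.
rewrite /schur_partitions /= filter_cat filter_map; congr (_ ++ map _ _).
rewrite -(filter_strict_partitions gN) -filter_predI; apply: eq_filter => s.
by rewrite /= is_schur_cons.
Qed.

(** * The recurrence for the generating functions *)

Lemma schur_countE N m n :
  schur_count N m n =
  count (fun s => (sumn s == n) && (schur_weight s == m)) (schur_partitions N).
Proof.
pose forget (s : {bseq n of 'I_N.+1}) : seq nat := [seq val a | a <- s].
rewrite /schur_count cardE -(size_map forget) -size_filter.
apply/perm_size/uniq_perm.
- rewrite map_inj_uniq ?enum_uniq // => s t /(inj_map val_inj) st.
  exact: val_inj.
- by rewrite !filter_uniq // strict_partitions_uniq.
move=> t; rewrite mem_filter mem_schur_partitions.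
apply/mapP/and3P => [[s]|[/andP[st wt] sch tN]].
  rewrite mem_enum inE /= => /and3P[sch st wt] ->; split=> //; first exact/andP.
  by apply/allP => _ /mapP[a _ ->]; rewrite -ltnS ltn_ord.
have forgetK : [seq val a | a <- [seq inord a : 'I_N.+1 | a <- t]] = t.
  rewrite -map_comp map_id_in // => a /(allP tN) aN /=.
  by rewrite inordK.
have szt : (size [seq inord a : 'I_N.+1 | a <- t] <= n)%N.
  rewrite size_map -(eqP st); case/schur_strict/andP: sch => _.
  by elim: (t) => //= a r IH /andP[a0 /IH]; lia.
exists (Bseq szt); rewrite /forget //= mem_enum inE /= forgetK sch st.
by rewrite wt.
Qed.

Definition q_var : Zqx := ('X : {poly int})%:P.

Definition part_monomial (a : nat) : Zqx :=
  'X ^+ (1 + ~~ odd a)%N * q_var ^+ a.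

Lemma schur_polyE N :
  schur_poly N =
  \sum_(s <- schur_partitions N) 'X ^+ schur_weight s * q_var ^+ sumn s.
Proof.
apply/polyP => m; apply/polyP => n.
rewrite coef_schur_poly schur_countE; elim: schur_partitions => [|s r IH].
  by rewrite big_nil !coef0.
rewrite big_cons !coefD -IH /= PoszD -rmorphXn /= coefMC coefXn.
rewrite [m == _]eq_sym; case: (schur_weight s =P m) => _.
  by rewrite mul1r coefXn eq_sym andbT; case: eqP.
by rewrite mul0r coef0 andbF.
Qed.

Lemma schur_poly_rec N :
  schur_poly N.+1 =
  schur_poly N + part_monomial N.+1 * schur_poly (next_part_bound N.+1).
Proof.
rewrite !schur_polyE schur_partitionsS big_cat big_map /=; congr (_ + _).
rewrite mulr_sumr; apply: eq_bigr => s _.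
rewrite /part_monomial mulrACA -!exprD; congr ('X ^+ _ * _).
by rewrite /schur_weight /=; lia.
Qed.

Lemma schur_poly0 : schur_poly 0 = 1.
Proof. by rewrite schur_polyE /schur_partitions big_cons big_nil addr0 mul1r. Qed.

(** * The functional equations *)

Notation shift_x f := (f \Po (q_var ^+ 2 * 'X)).

Lemma shift_q : shift_x q_var = q_var.
Proof. exact: comp_polyC. Qed.

(** The factor of index 1 of [p_poly], with its exponents reduced. *)
Notation first_factor := (1 + 'X * q_var + 'X ^+ 2 * q_var ^+ 2 : Zqx).

(** The subtraction in 6 k - 1 truncates at k = 0, where [schur_poly 0] = 1 is
    the correct value of d_(-1); hence the block starting at k = 0 needs no
    separate treatment. *)
Lemma schur_poly_block k (Q := q_var ^+ (6 * k)) :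
  [/\ schur_poly (6 * k + 2) = schur_poly (6 * k + 1)
        + 'X ^+ 2 * (Q * q_var ^+ 2) * schur_poly (6 * k - 1),
      schur_poly (6 * k + 3) = schur_poly (6 * k + 2)
        + 'X * (Q * q_var ^+ 3) * schur_poly (6 * k - 1) &
      schur_poly (6 * k + 4) = schur_poly (6 * k + 3)
        + 'X ^+ 2 * (Q * q_var ^+ 4) * schur_poly (6 * k + 1)] /\
  [/\ schur_poly (6 * k + 5) = schur_poly (6 * k + 4)
        + 'X * (Q * q_var ^+ 5) * schur_poly (6 * k + 2),
      schur_poly (6 * k + 6) = schur_poly (6 * k + 5)
        + 'X ^+ 2 * (Q * q_var ^+ 6) * schur_poly (6 * k + 2) &
      schur_poly (6 * k + 7) = schur_poly (6 * k + 6)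
        + 'X * (Q * q_var ^+ 7) * schur_poly (6 * k + 4)].
Proof.
have step r b : next_part_bound (6 * k + r).+1 = b ->
    schur_poly (6 * k + r.+1) = schur_poly (6 * k + r)
      + 'X ^+ (1 + odd r) * (Q * q_var ^+ r.+1) * schur_poly b.
  move=> <-; rewrite addnS schur_poly_rec /part_monomial -addnS /Q -exprD.
  by congr (_ + 'X ^+ _ * _ * _); lia.
by split; split; rewrite (step _ _ (erefl _)) /=; congr (_ + _ * schur_poly _);
  rewrite /next_part_bound; lia.
Qed.

(** Both sides, as k varies, satisfy the same first order linear system.  The
    induction multiplies S of that system by F and uses the equations at k to
    express all values shifted by S through E and G; comparing with the
    unshifted system at k + 1 is then a polynomial identity. *)
Lemma functional_equations k :
  schur_poly (6 * k + 2) = first_factor * shift_x (schur_poly (6 * k - 1)) /\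
  schur_poly (6 * k + 4) = first_factor * shift_x (schur_poly (6 * k + 1)).
Proof.
elim: k => [|k [IHe IHg]].
  have d1 : schur_poly 1 = 1 + 'X * q_var.
    by rewrite schur_poly_rec schur_poly0 /part_monomial mulr1.
  have [[d2 d3 d4] _] := schur_poly_block 0.
  move: d2 d3 d4; rewrite !muln0 expr0 !add0n sub0n d1 schur_poly0 => d2 d3 d4.
  rewrite d4 d3 d2 !(rmorph1, rmorphD, rmorphM) /= comp_polyX shift_q.
  by split; ring.
have [[d2 d3 d4] [d5 d6 d7]] := schur_poly_block k.
have [[d8 d9 d10] _] := schur_poly_block k.+1.
move: d8 d9 d10.
rewrite (_ : 6 * k.+1 - 1 = 6 * k + 5)%N; last by lia.
rewrite (_ : 6 * k.+1 + 1 = 6 * k + 7)%N; last by lia.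
have -> : q_var ^+ (6 * k.+1) = q_var ^+ (6 * k) * q_var ^+ 6.
  by rewrite -exprD; congr (_ ^+ _); lia.
move: d2 d3 d4 d5 d6 d7 IHe IHg; set Q := q_var ^+ (6 * k).
have shiftQ : shift_x Q = Q by rewrite /Q rmorphXn /= shift_q.
clearbody Q.
move=> d2 d3 d4 d5 d6 d7 IHe IHg d8 d9 d10.
(* E and G are combinations of A and C, so F S E and F S G are combinations
   of F S A = E and F S C = G. *)
have shift_d2 : first_factor * shift_x (schur_poly (6 * k + 2)) =
    schur_poly (6 * k + 4) + 'X ^+ 2 * (Q * q_var ^+ 6)
      * schur_poly (6 * k + 2).
  rewrite {1}d2 !(rmorphD, rmorphM, rmorphXn) /= shiftQ comp_polyX !shift_q.
  rewrite IHg IHe; ring.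
have shift_d4 : first_factor * shift_x (schur_poly (6 * k + 4)) =
    first_factor * shift_x (schur_poly (6 * k + 2))
      + 'X * (Q * q_var ^+ 5) * schur_poly (6 * k + 2)
      + 'X ^+ 2 * (Q * q_var ^+ 8) * schur_poly (6 * k + 4).
  rewrite {1}d4 d3 !(rmorphD, rmorphM, rmorphXn) /= shiftQ comp_polyX !shift_q.
  (* Folding S E keeps the next rewriting from replacing E inside it. *)
  set s2 := shift_x (schur_poly (6 * k + 2)).
  rewrite IHg IHe; ring.
have shift_d5 : first_factor * shift_x (schur_poly (6 * k + 5)) =
    first_factor * shift_x (schur_poly (6 * k + 4)) +
      'X * (Q * q_var ^+ 7) *
      (first_factor * shift_x (schur_poly (6 * k + 2))).
  rewrite d5 !(rmorphD, rmorphM, rmorphXn) /= shiftQ comp_polyX !shift_q.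
  ring.
have shift_d7 : first_factor * shift_x (schur_poly (6 * k + 7)) =
    first_factor * shift_x (schur_poly (6 * k + 5)) +
      'X ^+ 2 * (Q * q_var ^+ 10) *
      (first_factor * shift_x (schur_poly (6 * k + 2))) +
      'X * (Q * q_var ^+ 9) *
      (first_factor * shift_x (schur_poly (6 * k + 4))).
  rewrite d7 d6 !(rmorphD, rmorphM, rmorphXn) /= shiftQ comp_polyX !shift_q.
  ring.
rewrite shift_d7 shift_d5 shift_d4 shift_d2 d10 d9 d8 d7 d6 d5.
by split; ring.
Qed.

(** * Nonnegativity of the quotients *)

(** Carrying the semiring structure makes the closure under sums, products and
    composition available at each of the three levels. *)
Definition nonneg_int : semiringClosed int :=
  (Num.Def.nneg_num_pred : {pred int}).
Definition nonneg_q : semiringClosed {poly int} :=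
  (polyOver_pred nonneg_int : {pred {poly int}}).
Definition nonneg_xq : semiringClosed Zqx :=
  (polyOver_pred nonneg_q : {pred Zqx}).

Definition nonneg_multiple (h f : Zqx) : Prop :=
  exists2 P : Zqx, P \in nonneg_xq & f = P * h.

Lemma nonneg_multipleD h f g :
  nonneg_multiple h f -> nonneg_multiple h g -> nonneg_multiple h (f + g).
Proof.
by move=> [P P0 ->] [S S0 ->]; exists (P + S); rewrite ?mulrDl // rpredD.
Qed.

Lemma nonneg_multipleM h f c : c \in nonneg_xq ->
  nonneg_multiple h f -> nonneg_multiple h (c * f).
Proof. by move=> c0 [P P0 ->]; exists (c * P); rewrite ?mulrA // rpredM. Qed.

Lemma x_nonneg : ('X : Zqx) \in nonneg_xq.
Proof. exact: polyOverX. Qed.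

Lemma q_nonneg : q_var \in nonneg_xq.
Proof. by rewrite polyOverC polyOverX. Qed.

Lemma monomial_nonneg i n a : 'X ^+ i * (q_var ^+ n * q_var ^+ a) \in nonneg_xq.
Proof. by rewrite !(rpredM, rpredX) ?x_nonneg ?q_nonneg. Qed.

Definition p_factor i : Zqx :=
  1 + 'X * q_var ^+ (2 * i - 1) + 'X ^+ 2 * q_var ^+ (4 * i - 2).

Lemma p_polyE n : p_poly n = \prod_(1 <= i < n.+1) p_factor i.
Proof.
apply: eq_bigr => i _.
by rewrite /p_factor -!mul_polyC !rmorphXn /= mulrC [X in _ + X]mulrC.
Qed.

Lemma p_factor_nonneg i : p_factor i \in nonneg_xq.
Proof. by rewrite !(rpredD, rpredM, rpredX, rpred1) ?x_nonneg ?q_nonneg. Qed.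

(** S maps the factor of index i to the factor of index i + 1. *)
Lemma p_poly_shift n : p_poly n.+1 = first_factor * shift_x (p_poly n).
Proof.
rewrite !p_polyE big_ltn // big_add1 rmorph_prod; congr (_ * _).
apply: eq_big_nat => i /andP[i0 _]; rewrite /p_factor.
rewrite !(rmorph1, rmorphD, rmorphM, rmorphXn) /= comp_polyX !shift_q.
have -> : (2 * i.+1 - 1 = 2 + (2 * i - 1))%N by lia.
have -> : (4 * i.+1 - 2 = 4 + (4 * i - 2))%N by lia.
rewrite !exprD; ring.
Qed.

Lemma shift_nonneg_multiple n f :
  nonneg_multiple (p_poly n) f ->
  nonneg_multiple (p_poly n.+1) (first_factor * shift_x f).
Proof.
case=> P P0 ->; exists (shift_x P); last by rewrite rmorphM p_poly_shift mulrCA.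
by rewrite polyOver_comp // rpredM ?rpredX ?x_nonneg ?q_nonneg.
Qed.

Lemma nonneg_multiple_pred n f :
  nonneg_multiple (p_poly n.+1) f -> nonneg_multiple (p_poly n) f.
Proof.
case=> P P0 ->; exists (P * p_factor n.+1); first by rewrite rpredM ?p_factor_nonneg.
by rewrite !p_polyE big_nat_recr //= mulrAC mulrA.
Qed.

Lemma schur_poly_nonneg_block k :
  nonneg_multiple (p_poly k) (schur_poly (6 * k - 1)) ->
  nonneg_multiple (p_poly k) (schur_poly (6 * k + 1)) ->
  [/\ nonneg_multiple (p_poly k.+1) (schur_poly (6 * k + 2)),
      nonneg_multiple (p_poly k) (schur_poly (6 * k + 3)) &
      nonneg_multiple (p_poly k.+1) (schur_poly (6 * k + 4))] /\
  [/\ nonneg_multiple (p_poly k.+1) (schur_poly (6 * k + 5)),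
      nonneg_multiple (p_poly k.+1) (schur_poly (6 * k + 6)) &
      nonneg_multiple (p_poly k.+1) (schur_poly (6 * k + 7))].
Proof.
move=> hA hC; have [eE eG] := functional_equations k.
have [[_ d3 _] [d5 d6 d7]] := schur_poly_block k.
have hE : nonneg_multiple (p_poly k.+1) (schur_poly (6 * k + 2)).
  by rewrite eE; exact: shift_nonneg_multiple.
have hG : nonneg_multiple (p_poly k.+1) (schur_poly (6 * k + 4)).
  by rewrite eG; exact: shift_nonneg_multiple.
have add a b c i j : nonneg_multiple a b -> nonneg_multiple a c ->
    nonneg_multiple a (b + 'X ^+ i * (q_var ^+ (6 * k) * q_var ^+ j) * c).
  move=> hb hc; apply: nonneg_multipleD => //; apply: nonneg_multipleM => //.
  exact: monomial_nonneg.
have h5 : nonneg_multiple (p_poly k.+1) (schur_poly (6 * k + 5)).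
  by rewrite d5; apply: (add _ _ _ 1%N).
have h6 : nonneg_multiple (p_poly k.+1) (schur_poly (6 * k + 6)).
  by rewrite d6; apply: add.
split; split=> //; last by rewrite d7; apply: (add _ _ _ 1%N).
by rewrite d3; apply: (add _ _ _ 1%N) => //; exact: nonneg_multiple_pred.
Qed.

Lemma schur_poly_nonneg_multiple k :
  nonneg_multiple (p_poly k) (schur_poly (6 * k - 1)) /\
  nonneg_multiple (p_poly k) (schur_poly (6 * k + 1)).
Proof.
elim: k => [|k [hA hC]].
  have p0 : p_poly 0 = 1 by rewrite p_polyE big_geq.
  rewrite p0 muln0 sub0n schur_poly0; split; first by exists 1; rewrite ?rpred1 ?mulr1.
  exists (schur_poly 1); last by rewrite mulr1.
  rewrite schur_poly_rec schur_poly0 mulr1 /part_monomial.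
  by rewrite rpredD ?rpred1 // rpredM ?rpredX ?x_nonneg ?q_nonneg.
have [_ [h5 _ h7]] := schur_poly_nonneg_block hA hC.
by split; [move: h5|move: h7]; congr (nonneg_multiple _ (schur_poly _)); lia.
Qed.

Lemma psdiv_nonneg (h f : Zqx) : h`_0 = 1 -> nonneg_multiple h f ->
  is_nonneg_poly (psdiv f h).
Proof.
move=> h0 [P P0 ->]; exists P; split=> [i|i k].
  by rewrite -(psdiv_unique (s := fun j => P`_j)) // => j; rewrite coefM.
by move/polyOverP/(_ i)/polyOverP/(_ k): P0.
Qed.

Lemma e_index_eq (n e : int) :
  6 * (e + chi_odd n - 1) < n + 3 * chi_odd n <= 6 * (e + chi_odd n) ->
  e_index n = e.
Proof.
move=> /andP[lo hi]; rewrite /e_index.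
rewrite (_ : Num.ceil _ = e + chi_odd n) ?addrK //.
apply: ceil_def; rewrite ltr_pdivlMr // ler_pdivrMr //.
by rewrite -[6%:R]/(6%:~R) -!intrM ltr_int ler_int ![_ * 6]mulrC lo hi.
Qed.

(** On the block of index k the divisor index is k or k + 1, depending on r
    only: e = 0 for r = 1, 3 and e = 1 for r = 2, 4, 5, 6. *)
Lemma e_index_block (k r : nat) (e : int) :
  6 * (e + odd r - 1) < (r + 3 * odd r)%N%:Z <= 6 * (e + odd r) ->
  e_index (6 * k + r)%N = k%:Z + e.
Proof.
move=> he; apply: e_index_eq; rewrite /chi_odd /= oddD oddM /=.
by move: he; case: (odd r); lia.
Qed.

(** The residues run over 1, ..., 6 rather than 0, ..., 5, to match the blocks:
    d_(6k+6) is obtained from d_(6k+5) and d_(6k+2). *)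
Lemma schur_poly_nonneg_quotient m : (0 < m)%N ->
  nonneg_multiple (p_poly `|e_index m|%N) (schur_poly m).
Proof.
move=> m0; have [hA hC] := schur_poly_nonneg_multiple (m.-1 %/ 6).
have [[h2 h3 h4] [h5 h6 _]] := schur_poly_nonneg_block hA hC.
have -> : m = (6 * (m.-1 %/ 6) + (m.-1 %% 6).+1)%N.
  by rewrite addnS mulnC -divn_eq prednK.
move: hC h2 h3 h4 h5 h6; set k := (m.-1 %/ 6)%N => h1 h2 h3 h4 h5 h6.
have : (m.-1 %% 6 < 6)%N by rewrite ltn_mod.
have p1 : `|(k%:Z + 1)%R|%N = k.+1 by lia.
have p0 : `|(k%:Z + 0)%R|%N = k by lia.
case: (m.-1 %% 6)%N => [|[|[|[|[|[|//]]]]]] _.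
- by rewrite (@e_index_block _ _ 0) ?p0.
- by rewrite (@e_index_block _ _ 1) ?p1.
- by rewrite (@e_index_block _ _ 0) ?p0.
- by rewrite (@e_index_block _ _ 1) ?p1.
- by rewrite (@e_index_block _ _ 1) ?p1.
- by rewrite (@e_index_block _ _ 1) ?p1.
Qed.

Lemma alladi_schurE m : alladi_schur m%:Z = schur_poly m.
Proof. by case: m => [|m]; rewrite /alladi_schur //= schur_poly0. Qed.

Theorem theorem1 :
  (forall n : int, 1 <= n -> is_nonneg_poly (dtilde n)) /\
  (forall n j : nat, (j <= n)%N -> nonneg_coefs (c_coef n j)).
Proof.
split=> [[m|//] m1|n j _].
  rewrite /dtilde alladi_schurE; apply: psdiv_nonneg; first exact: p_poly0.
  exact: schur_poly_nonneg_quotient.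
suff: is_nonneg_poly (c_coef n) by case=> P [-> P0].
apply: psdiv_nonneg; first exact: p_poly0.
have -> : alladi_schur (6 * n%:Z - 1) = schur_poly (6 * n - 1).
  case: n => [|n]; first by rewrite schur_poly0.
  by rewrite -alladi_schurE; congr alladi_schur; lia.
by have [] := schur_poly_nonneg_multiple n.
Qed.
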